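(* Let $U$ be a universal self-delimiting Turing machine. Then its zeta number $\zeta_U=\sum_{n\ge 1,\ \mathrm{bin}(n)\in\mathrm{dom}(U)} \frac{1}{n}$ is (algorithmically) random.
   Context: All Turing machines considered map binary strings to binary strings (partial functions on $\Sigma^*$, $\Sigma=\{0,1\}$); $\mathrm{dom}(M)$ is the set of inputs on which $M$ halts. A Turing machine is self-delimiting if its domain is prefix-free. A self-delimiting Turing machine $U$ is universal if for every self-delimiting Turing machine $C$ there is a constant $c\ge 0$ such that for every $x\in\mathrm{dom}(C)$ there is $p_x\in\mathrm{dom}(U)$ with $|p_x|\le |x|+c$ and $U(p_x)=C(x)$. $\mathrm{bin}:\mathbf{N}=\{1,2,\dots\}\to\Sigma^*$ is the bijection sending $n$ to its binary expansion with the leading 1 removed (so $\mathrm{bin}(1)$ is the empty string, $\mathrm{bin}(2)=0$, $\mathrm{bin}(3)=1$, $\mathrm{bin}(4)=00$). For a real $\alpha\in(0,1)$, $\alpha[m]$ denotes the first $m$ bits of its unending binary expansion. For a self-delimiting machine $C$, $H_C(x)=\min\{|w| : C(w)=x\}$. Fix a universal self-delimiting Turing machine $U_0$; a real $\alpha\in(0,1)$ is random if there is $c\ge 0$ with $H_{U_0}(\alpha[m])\ge m-c$ for all $m\ge 1$. *)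

(* Defs.v *)
From HB Require Import structures.
From mathcomp Require Import all_boot all_order all_algebra.
From mathcomp Require Import mathcomp_extra boolp classical_sets reals ereal.
From mathcomp Require Import topology normedtype sequences.

Set Implicit Arguments.
Unset Strict Implicit.
Unset Printing Implicit Defensive.

Import Order.TTheory GRing.Theory Num.Theory.
Import numFieldNormedType.Exports.

Local Open Scope classical_set_scope.
Local Open Scope ring_scope.

(** * Turing machines *)

Inductive move := MoveL | Stay | MoveR.

(* Deterministic Turing machines with finitely many two-way infinite tapes.
   A cell holds [None] (blank), [Some (inl b)] (the bit [b]) or
   [Some (inr a)] ([a] an auxiliary symbol).  The machine reads the cells under
   all its heads; [tm_delta] returns [None] to halt, or else the next state and,
   for every tape, the symbol to write and the move of the head. *)
Record turing_machine := TuringMachine {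
  tm_tapes : nat; (* the number of tapes, minus one *)
  tm_aux : finType;
  tm_state : finType;
  tm_start : tm_state;
  tm_delta : tm_state ->
    {ffun 'I_tm_tapes.+1 -> option (bool + tm_aux)} ->
    option (tm_state *
            {ffun 'I_tm_tapes.+1 -> option (bool + tm_aux) * move})
}.

Definition cell (M : turing_machine) : Type := option (bool + tm_aux M).

(* [tape_left] lists the cells to the left of the head, nearest first; all the
   cells beyond the two lists are blank. *)
Record tape (M : turing_machine) := Tape {
  tape_left : seq (cell M);
  tape_cur : cell M;
  tape_right : seq (cell M)
}.

Record config (M : turing_machine) := Config {
  cfg_state : tm_state M;
  cfg_tape : {ffun 'I_(tm_tapes M).+1 -> tape M}
}.

Section Execution.
Variable M : turing_machine.

Definition blank : cell M := None.
Definition bit (b : bool) : cell M := Some (inl b).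

Definition write_move (a : cell M * move) (t : tape M) : tape M :=
  let: Tape l _ r := t in
  match a.2 with
  | MoveL => Tape (behead l) (head blank l) (a.1 :: r)
  | Stay => Tape l a.1 r
  | MoveR => Tape (a.1 :: l) (head blank r) (behead r)
  end.

Definition step (c : config M) : option (config M) :=
  if tm_delta (cfg_state c) [ffun i => tape_cur (cfg_tape c i)] is Some (q, a)
  then Some (Config q [ffun i => write_move (a i) (cfg_tape c i)])
  else None.

Definition input_tape (x : seq bool) : tape M :=
  Tape [::] (head blank (map bit x)) (behead (map bit x)).

(* The input is on tape 0, with the head on its first bit. *)
Definition init (x : seq bool) : config M :=
  Config (tm_start M)
    [ffun i => input_tape (if i == ord0 then x else [::])].

Fixpoint leading_bits (s : seq (cell M)) : seq bool :=
  if s is Some (inl b) :: s' then b :: leading_bits s' else [::].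

(* The output is the longest block of bits on tape 0 starting under the head
   and extending to the right. *)
Definition output (c : config M) : seq bool :=
  leading_bits (tape_cur (cfg_tape c ord0) :: tape_right (cfg_tape c ord0)).

(* [computes x y]: on input [x] the machine halts with output [y]. *)
Definition computes (x y : seq bool) : Prop :=
  exists (t : nat) (c : config M),
    [/\ iter t (obind step) (Some (init x)) = Some c,
        step c = None & output c = y].

Definition dom : set (seq bool) := [set x | exists y, computes x y].

Definition self_delimiting : Prop :=
  forall x y, dom x -> dom y -> prefix x y -> x = y.

End Execution.

Definition universal (U : turing_machine) : Prop :=
  self_delimiting U /\
  forall C : turing_machine, self_delimiting C ->
    exists c : nat, forall x y, computes C x y ->
      exists2 p, (size p <= size x + c)%N & computes U p y.

(** * Program-size complexity and randomness *)

(* The infimum is a minimum, or [+oo] when no program outputs [x]. *)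
Definition complexity (R : realType) (C : turing_machine) (x : seq bool) :
    \bar R :=
  ereal_inf [set ((size w)%:R)%:E | w in [set w | computes C w x]].

(* [b i] is the bit of weight [2 ^- i.+1]; an expansion is unending when it has
   infinitely many ones, so every real in (0, 1) has exactly one. *)
Definition unending_expansion (R : realType) (b : nat -> bool) (alpha : R) :
    Prop :=
  (fun n => \sum_(0 <= i < n) (b i)%:R / 2 ^+ i.+1) @ \oo --> alpha /\
  forall n, exists2 i, (n <= i)%N & b i.

Definition random (R : realType) (U0 : turing_machine) (alpha : R) : Prop :=
  0 < alpha < 1 /\
  exists2 b : nat -> bool, unending_expansion b alpha &
    exists c : nat, forall m : nat, (1 <= m)%N ->
      ((m%:R - c%:R)%:E <= complexity R U0 (mkseq b m))%E.

(** * The zeta number of a machine *)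

(* The bits of [n >= 1] of weight below that of its leading 1, most significant
   first. *)
Definition bin (n : nat) : seq bool :=
  rev (mkseq (fun i => odd (n %/ 2 ^ i)%N) (trunc_log 2 n)).

(* The limit of a divergent sequence is [0] by convention, so [random] cannot
   hold of [zeta R U] unless the series converges. *)
Definition zeta (R : realType) (U : turing_machine) : R :=
  limn (fun N => \sum_(1 <= n < N | `[< dom U (bin n) >]) n%:R^-1 : R).

(* Main.v *)
(* By Kraft's inequality zeta_U converges.  Let U0 map w to the first m bits of
   zeta_U, so that their value v/2^m satisfies v/2^m < zeta_U <= (v+1)/2^m.  From
   w one can search for a t such that the sum of 1/n over the n <= t for which U
   halts on bin(n) within t steps exceeds v/2^m.  A program p = bin(n) of U with
   |p| < m contributes 1/n > 2^-m to zeta_U, hence it has halted within t steps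
   and its output has length at most 2t.  The string 1^(2t+1) is therefore not the
   output of a program of U shorter than m, while universality of U bounds its
   complexity by |w| + c; thus m <= |w| + c.

   The machine mapping w to 1^(2t+1) is written in a small structured language
   over stacks, in which the tapes of U0 and U are pairs of stacks and natural
   numbers are unary counters. *)
Require Import Defs.
From mathcomp Require Import all_boot all_order all_algebra perm.
From mathcomp Require Import boolp classical_sets reals ereal.
From mathcomp Require Import topology normedtype sequences.
From mathcomp Require Import ring lra zify.

Set Implicit Arguments.
Unset Strict Implicit.
Unset Printing Implicit Defensive.

Import Order.TTheory GRing.Theory Num.Theory.
Import numFieldNormedType.Exports.

(** * Stack programs and their compilation *)

(** The unending expansion is what makes the search end: it keeps [v / 2 ^ m] strictly below the
    zeta number, so some partial sum exceeds it. With a terminating expansion the two could be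
    equal, and no partial sum exceeds the zeta number.

    The output [1^(2t+1)] replaces the usual list of all outputs of short programs: a machine writes
    at most one cell per step, so a bound on running times already bounds the lengths of these
    outputs, and one longer word avoids them all. A single [t] bounds both the candidates [n] and
    their running times, so the search has only one parameter.

    Universality speaks of actual Turing machines with prefix-free domain. Hence the diagonal
    procedure must be built as one, with sums kept as exact fractions and compared by
    cross-multiplication. It runs [U0] on [w] to the end before anything else, so its domain lies
    inside that of [U0], whether or not the search ends on other inputs. *)

(* [None] leaves a stack unchanged and [Some None] pops it. *)
Definition apply_op (T : Type) (o : option (option T)) (s : seq T) : seq T :=
  match o with
  | None => s
  | Some None => behead s
  | Some (Some a) => a :: s
  end.

Section StackPrograms.
Variables (F aux I : finType) (i0 : I).

Local Notation sym := (bool + aux)%type.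

Definition stack_op := option (option sym).

Definition store : Type := F * (I -> seq sym).

Definition tops (s : I -> seq sym) (i : I) : option sym := ohead (s i).

Inductive program :=
| Basic of (F -> (I -> option sym) -> F * (I -> stack_op))
| Seq of program & program
| While of (F -> (I -> option sym) -> bool) & program.

Definition apply_basic f (s : store) : store :=
  let r := f s.1 (tops s.2) in (r.1, fun i => apply_op (r.2 i) (s.2 i)).

Inductive exec : program -> store -> store -> Prop :=
| ExecBasic f s : exec (Basic f) s (apply_basic f s)
| ExecSeq c1 c2 s1 s2 s3 :
    exec c1 s1 s2 -> exec c2 s2 s3 -> exec (Seq c1 c2) s1 s3
| ExecWhileTrue (b : F -> (I -> option sym) -> bool) c s1 s2 s3 :
    b s1.1 (tops s1.2) -> exec c s1 s2 -> exec (While b c) s2 s3 ->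
    exec (While b c) s1 s3
| ExecWhileFalse (b : F -> (I -> option sym) -> bool) c s :
    ~~ b s.1 (tops s.2) -> exec (While b c) s s.

(** The additional point [None] of a loop is its test. Since [None] also marks the end of the body,
    finishing the body leads back to the test without a special case. *)
Fixpoint point (c : program) : finType :=
  match c with
  | Basic _ => unit
  | Seq c1 c2 => (point c1 + point c2)%type
  | While _ c => option (point c)
  end.

Fixpoint entry (c : program) : point c :=
  match c with
  | Basic _ => tt
  | Seq c1 c2 => inl (entry c1)
  | While _ c => None
  end.

Fixpoint next (c : program) :
    point c -> F -> (I -> option sym) -> option (point c) * (F * (I -> stack_op)) :=
  match c with
  | Basic f => fun _ q tp => (None, f q tp)
  | Seq c1 c2 => fun p q tp =>
      match p with
      | inl p1 => let r := next p1 q tp in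
          (Some (if r.1 is Some p' then inl p' else inr (entry c2)), r.2)
      | inr p2 => let r := next p2 q tp in (omap inr r.1, r.2)
      end
  | While b c => fun p q tp =>
      match p with
      | None => (if b q tp then Some (Some (entry c)) else None, (q, fun=> None))
      | Some p' => let r := next p' q tp in (Some r.1, r.2)
      end
  end.

Definition next_store c (p : point c) : store -> store :=
  apply_basic (fun q tp => (next p q tp).2).

Definition next_point c (p : point c) (s : store) := (next p s.1 (tops s.2)).1.

Inductive run c : option (point c) -> store -> store -> Prop :=
| RunDone s : run None s s
| RunNext p s1 s2 : run (next_point p s1) (next_store p s1) s2 -> run (Some p) s1 s2.

Lemma run_seq c1 c2 p s1 s2 s3 :
  run p s1 s2 -> run (Some (entry c2)) s2 s3 ->
  @run (Seq c1 c2) (Some (if p is Some p' then inl p' else inr (entry c2))) s1 s3.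
Proof.
have inr_run q s s' : run q s s' -> @run (Seq c1 c2) (omap inr q) s s'.
  by elim=> [t|q' t t' _ IH] /=; [exact: RunDone|apply: RunNext].
move=> r12 r23; elim: r12 r23 => [s|p' s s' _ IH] r23; first exact: (inr_run (Some _)).
by apply: RunNext; apply: IH.
Qed.

Lemma run_while b c p s1 s2 s3 :
  run p s1 s2 -> @run (While b c) (Some None) s2 s3 ->
  @run (While b c) (Some p) s1 s3.
Proof.
by elim=> [s|p' s s' _ IH] r23 //; apply: RunNext; apply: IH.
Qed.

Lemma exec_run c s s' : exec c s s' -> run (Some (entry c)) s s'.
Proof.
have idE (t : store) : (t.1, fun i => t.2 i) = t by case: t.
elim=> {c s s'} [f s|c1 c2 s1 s2 s3 _ r1 _ r2|b c s1 s2 s3 bs _ r1 _ r2|b c s bs].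
- by apply: RunNext; apply: RunDone.
- exact: (run_seq r1 r2).
- apply: RunNext; rewrite /next_point /next_store /apply_basic /= bs idE.
  exact: run_while r1 r2.
- apply: RunNext; rewrite /next_point /next_store /apply_basic /= (negbTE bs) idE.
  exact: RunDone.
Qed.

Lemma run_seq_inv c1 c2 p s s' :
  @run (Seq c1 c2) p s s' ->
  match p with
  | None => s' = s
  | Some (inl p1) =>
      exists2 t, run (Some p1) s t & run (Some (entry c2)) t s'
  | Some (inr p2) => run (Some p2) s s'
  end.
Proof.
elim=> [t //|[p1|p2] t t' /= _].
  rewrite /next_point /=; case E: (next _ _ _).1 => [p'|] /=.
    by case=> u r1 r2; exists u => //; apply: RunNext; rewrite /next_point E.
  move=> r2; exists (next_store p1 t) => //.
  by apply: RunNext; rewrite /next_point E; apply: RunDone.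
rewrite /next_point /=; case E: (next _ _ _).1 => [p'|] /= r2;
  apply: RunNext; rewrite /next_point E //.
by rewrite r2; apply: RunDone.
Qed.

Lemma run_exec c s s' : run (Some (entry c)) s s' -> exec c s s'.
Proof.
have idE (t : store) : (t.1, fun i => t.2 i) = t by case: t.
elim: c s s' => [f|c1 IH1 c2 IH2|b c IH] s s' r.
- suff: forall p u u', @run (Basic f) p u u' ->
      u' = if p is Some _ then apply_basic f u else u.
    by move/(_ _ _ _ r) => ->; apply: ExecBasic.
  by move=> p u u'; elim.
- by have [t /IH1 ? /IH2 ?] := run_seq_inv r; apply: ExecSeq; eassumption.
suff: forall p u u', @run (While b c) p u u' ->
    match p with
    | None => u' = u
    | Some None => exec (While b c) u u'
    | Some (Some p') => exists2 t, run (Some p') u t & exec (While b c) t u'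
    end by move/(_ _ _ _ r).
move=> p u u'; elim=> {p u u'} [u //|[p|] u u' _].
  rewrite /next_point /=; case E: (next _ _ _).1 => [p'|] /=.
    by case=> t r1 r2; exists t => //; apply: RunNext; rewrite /next_point E.
  move=> r2; exists (next_store p u) => //.
  by apply: RunNext; rewrite /next_point E; apply: RunDone.
rewrite /next_point /next_store /apply_basic /= idE.
case bu : (b _ _); last by move=> ->; apply: ExecWhileFalse; rewrite bu.
by case=> t /IH r1 r2; apply: ExecWhileTrue bu r1 r2.
Qed.

Lemma execP c s s' : exec c s s' <-> run (Some (entry c)) s s'.
Proof. by split; [apply: exec_run|apply: run_exec]. Qed.

Lemma card_index : #|I|.-1.+1 = #|I|.
Proof. by apply: prednK; apply/card_gt0P; exists i0. Qed.

Local Notation width := #|I|.-1.+1.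

(** The transposition puts the stack [i0] on tape 0, the tape of the input and the output. *)
Definition index_of (j : 'I_width) : I :=
  tperm (enum_val (cast_ord card_index ord0)) i0 (enum_val (cast_ord card_index j)).

Definition tape_of (i : I) : 'I_width :=
  cast_ord (esym card_index)
    (enum_rank (tperm (enum_val (cast_ord card_index ord0)) i0 i)).

Lemma tape_ofK : cancel tape_of index_of.
Proof. by move=> i; rewrite /index_of /tape_of cast_ordKV enum_rankK tpermK. Qed.

Lemma index_ofK : cancel index_of tape_of.
Proof. by move=> j; rewrite /index_of /tape_of tpermK enum_valK cast_ordK. Qed.

Lemma index_of0 : index_of ord0 = i0.
Proof. by rewrite /index_of tpermL. Qed.

(** * Compilation to Turing machines, one tape per stack *)

Section Compile.
Variables (c : program) (q0 : F).

(* The third component holds pushes that are still to be written: each program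
   step takes two machine steps, the first moves the heads and the second writes
   the pushed symbols. *)
Definition machine_state : finType :=
  (option (point c) * F * option {ffun 'I_width -> option sym})%type.

Definition stack_delta (s : machine_state) (rd : {ffun 'I_width -> option sym}) :
    option (machine_state * {ffun 'I_width -> option sym * move}) :=
  let q := s.1.2 in
  match s.2, s.1.1 with
  | Some w, p =>
      Some ((p, q, None),
        [ffun j => (if w j is Some a then Some a else rd j, Stay)])
  | None, None => None
  | None, Some p =>
      let r := next p q (fun i => rd (tape_of i)) in
      Some ((r.1, r.2.1,
              Some [ffun j => if r.2.2 (index_of j) is Some o then o else None]),
        [ffun j => match r.2.2 (index_of j) with
          | None => (rd j, Stay)
          | Some None => (None, MoveR)
          | Some (Some _) => (rd j, if rd j is None then Stay else MoveL)
          end])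
  end.

Definition stack_machine : turing_machine :=
  @TuringMachine #|I|.-1 aux machine_state (Some (entry c), q0, None) stack_delta.

(** The top is under the head and the bottom is far to the right. A pop blanks its cell before
    moving right, so only blanks lie to the left; [n] counts those that are explicit in the list. *)
Definition holds_stack (t : tape stack_machine) (s : seq sym) : Prop :=
  exists n, t = Tape (M := stack_machine)
    (nseq n None) (ohead s) (behead (map Some s)).

Definition represents (p : option (point c)) (s : store) (d : config stack_machine) :=
  cfg_state d = (p, s.1, None) /\
  forall j, holds_stack (cfg_tape d j) (s.2 (index_of j)).

Lemma holds_stack_cur t s : holds_stack t s -> tape_cur t = ohead s.
Proof. by case=> n ->. Qed.

Lemma represents_step p s d : represents (Some p) s d ->
  exists2 d', obind (@step _) (step d) = Some d' &
    represents (next_point p s) (next_store p s) d'.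
Proof.
case=> ds dt; rewrite [step d]/step ds.
have rdE : (fun i => [ffun j => tape_cur (cfg_tape d j)] (tape_of i)) = tops s.2.
  by apply: funext => i; rewrite ffunE (holds_stack_cur (dt _)) tape_ofK.
rewrite /= rdE /step /=; eexists; first by [].
split=> // j /=; rewrite !ffunE /=.
have [n ->] := dt j; rewrite /next_store /apply_basic /=.
rewrite /apply_op; case: ((next p s.1 (tops s.2)).2.2 (index_of j)) => [[a|]|] /=.
- case: (s.2 _) => [|x l] /=; first by exists n.
  by exists n.-1; case: n.
- by exists n.+1; case: (s.2 _) => [|x [|y l]].
- by exists n.
Qed.

Lemma represents_halt s d : represents None s d -> step d = None.
Proof. by case=> ds _; rewrite /step ds. Qed.

Definition input_store (x : seq bool) : store :=
  (q0, fun i => if i == i0 then map inl x else [::]).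

Fixpoint leading_bools (s : seq sym) : seq bool :=
  if s is inl b :: s' then b :: leading_bools s' else [::].

Lemma represents_init x :
  represents (Some (entry c)) (input_store x) (init stack_machine x).
Proof.
split=> // j; rewrite /= ffunE -(inj_eq (can_inj index_ofK)) index_of0.
by exists 0%N; case: ifP => // _; rewrite /input_tape -map_comp; case: x.
Qed.

Lemma represents_output p s d : represents p s d ->
  output d = leading_bools (s.2 i0).
Proof.
case=> _ /(_ ord0) [n]; rewrite index_of0 /output => ->.
by case: (s.2 i0) => //= -[b|//] l; congr cons; elim: l => //= -[b'|//] l ->.
Qed.

Lemma run_machine p s s' d : represents p s d -> run p s s' ->
  exists (t : nat) d', iter t (obind (@step _)) (Some d) = Some d' /\
    represents None s' d'.
Proof.
move=> rd r; elim: r d rd => [u|p' u u' _ IH] d rd; first by exists 0%N, d.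
have [d1 e1 /IH [t [d' [e' r']]]] := represents_step rd.
by exists t.+2, d'; split=> //; rewrite !iterSr -e' -e1.
Qed.

Lemma machine_run t p s d d' : represents p s d ->
  iter t (obind (@step _)) (Some d) = Some d' -> step d' = None ->
  exists2 s', run p s s' & represents None s' d'.
Proof.
have iter_None n : iter n (obind (@step stack_machine)) None = None.
  by elim: n => //= n ->.
elim/ltn_ind: t p s d => t IH [p|] s d rd.
  have [d1 e1 rd1] := represents_step rd.
  (* The machine can stop neither at a program point nor halfway through the two steps that simulate
     it. *)
  case: t IH => [|[|t]] IH.
  - by move=> [<-] h; move: e1; rewrite h.
  - by move=> /= h1 h2; move: e1; rewrite h1 /= h2.
  rewrite !iterSr [obind _ (Some d)]/= e1 => h1 h2.
  have [s' r' rd'] := IH t (ltnW (ltnSn _)) _ _ _ rd1 h1 h2.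
  by exists s' => //; apply: RunNext.
case: t IH => [|t] _; last by rewrite iterSr /= (represents_halt rd) iter_None.
by move=> [<-] _; exists s => //; apply: RunDone.
Qed.

(** The direction from halting to [exec] bounds domains from above, which is how the machines below
    are shown to be self-delimiting. *)
Lemma stack_machine_computes x y :
  computes stack_machine x y <->
  exists2 s, exec c (input_store x) s & y = leading_bools (s.2 i0).
Proof.
split=> [[t [d [it hd <-]]]|[s /execP r ->]].
  have [s r rd] := machine_run (represents_init x) it hd.
  by exists s; [apply/execP|apply: represents_output rd].
have [t [d [it rd]]] := run_machine (represents_init x) r.
exists t, d; split=> //; first exact: represents_halt rd.
exact: represents_output rd.
Qed.

End Compile.
End StackPrograms.

Section ExecWhile.
Variables (F aux I : finType).

Lemma exec_while_iter (b : F -> (I -> option (bool + aux)) -> bool) c n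
    (s : nat -> store F aux I) :
  (forall k, (k < n)%N -> b (s k).1 (tops (s k).2) /\ exec c (s k) (s k.+1)) ->
  ~~ b (s n).1 (tops (s n).2) -> exec (While b c) (s 0) (s n).
Proof.
elim: n s => [|n IH] s hs hn; first exact: ExecWhileFalse.
have [b0 e0] := hs 0 (ltn0Sn n).
apply: ExecWhileTrue b0 e0 _; apply: (IH (s \o succn)) => // k kn.
exact: (hs k.+1).
Qed.

Lemma exec_det (c : program F aux I) s s1 s2 : exec c s s1 -> exec c s s2 -> s1 = s2.
Proof.
move=> h; elim: h s2 => {c s s1}.
- by move=> f s s2 h; inversion_clear h.
- move=> c1 c2 s t u _ IH1 _ IH2 s2 h; inversion_clear h.
  by apply: IH2; rewrite (IH1 _ H).
- move=> b c s t u bs _ IH1 _ IH2 s2 h.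
  inversion h as [| |b' c' r1 r2 r3 hb hc hw|b' c' r hb]; subst; last by rewrite bs in hb.
  by apply: IH2; rewrite (IH1 _ hc).
- move=> b c s bs s2 h.
  inversion h as [| |b' c' r1 r2 r3 hb hc hw|b' c' r hb]; subst => //.
  by rewrite hb in bs.
Qed.

End ExecWhile.

(** * Configurations as a finite control and two stacks per tape *)

Section MachineOps.
Variable M : turing_machine.
Local Notation cellM := (option (bool + tm_aux M)).

(** The scanned cells belong to the finite part, so that a head move is one push and one pop on the
    two halves of its tape. *)
Definition control : finType :=
  (tm_state M * {ffun 'I_(tm_tapes M).+1 -> cellM})%type.

Definition control_of (c : config M) : control :=
  (cfg_state c, [ffun i => tape_cur (cfg_tape c i)]).

Definition half_tape (c : config M) (i : 'I_(tm_tapes M).+1) (right : bool) :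
    seq cellM :=
  if right then tape_right (cfg_tape c i) else tape_left (cfg_tape c i).

Definition tape_op : Type :=
  control -> ('I_(tm_tapes M).+1 -> bool -> option cellM) ->
  control * ('I_(tm_tapes M).+1 -> bool -> option (option cellM)).

Definition performs (op : tape_op) (c c' : config M) : Prop :=
  let r := op (control_of c) (fun i b => ohead (half_tape c i b)) in
  r.1 = control_of c' /\
  forall i b, apply_op (r.2 i b) (half_tape c i b) = half_tape c' i b.

Lemma config_eq (c c' : config M) : cfg_state c = cfg_state c' ->
  (forall i, cfg_tape c i = cfg_tape c' i) -> c = c'.
Proof. by case: c c' => [q t] [q' t'] /= -> /ffunP ->. Qed.

Definition halted (q : control) : bool :=
  if tm_delta q.1 q.2 is Some _ then false else true.

Lemma halted_control c : halted (control_of c) = ~~ isSome (step c).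
Proof. by rewrite /halted /step /=; case: tm_delta => // -[]. Qed.

Definition step_op : tape_op := fun q tp =>
  if tm_delta q.1 q.2 is Some (q', a) then
    ((q', [ffun i => match (a i).2 with
                     | MoveL => odflt None (tp i false)
                     | Stay => (a i).1
                     | MoveR => odflt None (tp i true)
                     end]),
     fun i right => match (a i).2 with
       | MoveL => Some (if right then Some (a i).1 else None)
       | Stay => None
       | MoveR => Some (if right then None else Some (a i).1)
       end)
  else (q, fun _ _ => None).

Lemma step_opP c c' : step c = Some c' -> performs step_op c c'.
Proof.
rewrite /step /performs /step_op /=; case: tm_delta => // -[q a] [<-]; split.
  congr (_, _); apply/ffunP => i; rewrite !ffunE /half_tape /=.
  by case: (cfg_tape c i) => l x r /=; case: (a i) => y [] //=; case: l; case: r.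
move=> i b; rewrite /half_tape /= ffunE.
by case: (cfg_tape c i) => l x r /=; case: (a i) => y [] //=; case: b.
Qed.

(** A move to the right that forgets the cell it leaves: it starts a run on a loaded word and
    consumes an output bit by bit. *)
Definition advance_op : tape_op := fun q tp =>
  ((q.1, [ffun i => if i == ord0 then odflt None (tp i true) else q.2 i]),
   fun i right => if (i == ord0) && right then Some None else None).

Definition advance (c : config M) : config M :=
  let t := cfg_tape c ord0 in
  Config (cfg_state c)
    [ffun i => if i == ord0
               then Tape (tape_left t) (head None (tape_right t)) (behead (tape_right t))
               else cfg_tape c i].

Lemma advance_opP c : performs advance_op c (advance c).
Proof.
split=> [|i b]; rewrite /advance_op /advance /half_tape /=.
  congr (_, _); apply/ffunP => i; rewrite !ffunE.
  by case: eqP => [->|//] /=; case: (tape_right _).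
by rewrite ffunE; case: eqP => [->|//] /=; case: b.
Qed.

Definition push_op (a : cellM) : tape_op := fun q tp =>
  (q, fun i right => if (i == ord0) && right then Some (Some a) else None).

Definition pushed (a : cellM) (c : config M) : config M :=
  let t := cfg_tape c ord0 in
  Config (cfg_state c)
    [ffun i => if i == ord0 then Tape (tape_left t) (tape_cur t) (a :: tape_right t)
               else cfg_tape c i].

Lemma push_opP a c : performs (push_op a) c (pushed a c).
Proof.
split=> [|i b]; rewrite /push_op /pushed /half_tape /=.
  by congr (_, _); apply/ffunP => i; rewrite !ffunE; case: eqP => [->|].
by rewrite ffunE; case: eqP => [->|//] /=; case: b.
Qed.

Definition pop_op : tape_op := fun q _ => (q, fun _ _ => Some None).

Definition popped (c : config M) : config M :=
  Config (cfg_state c)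
    [ffun i => let: Tape l x r := cfg_tape c i in Tape (behead l) x (behead r)].

Lemma pop_opP c : performs pop_op c (popped c).
Proof.
split=> [|i b]; rewrite /pop_op /popped /half_tape /=.
  by congr (_, _); apply/ffunP => i; rewrite !ffunE; case: (cfg_tape c i).
by rewrite ffunE; case: (cfg_tape c i) => l x r /=; case: b.
Qed.

Definition reset_op : tape_op := fun _ _ =>
  ((tm_start M, [ffun=> None]), fun _ _ => None).

(* The word [x] is entirely to the right of the head of tape 0; [advance] brings
   the head to its first bit. *)
Definition loaded (x : seq bool) : config M :=
  Config (tm_start M)
    [ffun i => Tape [::] None (if i == ord0 then map (@bit M) x else [::])].

Lemma advance_loaded x : advance (loaded x) = init M x.
Proof.
apply: config_eq => // i; rewrite /advance /= !ffunE /input_tape.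
by case: eqP.
Qed.

Lemma pushed_loaded b x : pushed (bit M b) (loaded x) = loaded (b :: x).
Proof.
by apply: config_eq => // i; rewrite /pushed /= !ffunE /=; case: eqP.
Qed.

Lemma reset_opP c : (forall i b, half_tape c i b = [::]) ->
  performs reset_op c (loaded [::]).
Proof.
move=> ce; split=> [|i b] /=.
  by congr (_, _); apply/ffunP => i; rewrite !ffunE.
by rewrite ce /half_tape /= ffunE if_same; case: b.
Qed.

(** A total form of execution in which a halted configuration repeats forever, so that having halted
    within [k] steps depends on the [k]-th term alone. *)
Definition stutter (c : config M) (k : nat) : config M :=
  iter k (fun c => odflt c (step c)) c.

Lemma stutter_halted c k : step c = None -> stutter c k = c.
Proof. by move=> h; elim: k => //= k ->; rewrite h. Qed.

End MachineOps.

(** * Halting times and output lengths *)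

Section HaltingTimes.
Variable M : turing_machine.

Lemma computes_stutter x y : computes M x y -> exists k, forall j, (k <= j)%N ->
  step (stutter (init M x) j) = None /\ output (stutter (init M x) j) = y.
Proof.
case=> k [c [it hc hy]]; exists k => j kj.
have e : stutter (init M x) k = c.
  have gen c0 t c1 : iter t (obind (@step M)) (Some c0) = Some c1 -> stutter c0 t = c1.
    elim: t c0 => [|t IH] c0; first by case.
    rewrite iterSr /stutter iterSr /=; case: (step c0) => [c2|]; first exact: IH.
    by have -> : iter t (obind (@step M)) None = None by elim: t {IH} => //= t ->.
  exact: gen it.
by rewrite -(subnK kj) /stutter iterD -/(stutter _ k) e -/(stutter _ _) stutter_halted.
Qed.

Lemma computes_inj x y z : computes M x y -> computes M x z -> y = z.
Proof.
move=> /computes_stutter [k hk] /computes_stutter [l hl].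
by rewrite -(hk _ (leq_maxl k l)).2 -(hl _ (leq_maxr k l)).2.
Qed.

Lemma stutter_computes x t : step (stutter (init M x) t) = None ->
  computes M x (output (stutter (init M x) t)).
Proof.
move=> ht; suff [k it] : exists k, iter k (obind (@step M)) (Some (init M x)) =
    Some (stutter (init M x) t) by exists k, (stutter (init M x) t).
elim: t (init M x) ht => [|t IH] c; first by exists 0%N.
rewrite /stutter iterSr; case E: (step c) => [c'|] /= ht.
  by have [k hk] := IH c' ht; exists k.+1; rewrite iterSr /= E.
by exists 0%N; rewrite -/(stutter c t) stutter_halted.
Qed.

(** The output fits in the scanned cell and the right half of tape 0. That half starts with the
    input minus its first bit, and only a left move lengthens it, by one cell. *)
Lemma size_output_stutter x t :
  (size (output (stutter (init M x) t)) <= (size x).-1 + t + 1)%N.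
Proof.
have lead s : (size (leading_bits (M := M) s) <= size s)%N.
  by elim: s => //= -[[b|a]|] s IH //=.
suff h : (size (tape_right (cfg_tape (stutter (init M x) t) ord0)) <= (size x).-1 + t)%N.
  by rewrite addn1; apply: leq_trans (lead _) _.
elim: t => [|t IH].
  by rewrite /= ffunE eqxx /input_tape /= size_behead size_map addn0.
rewrite /stutter iterS -/(stutter _ t); case E: (step _) => [c|] /=; last first.
  by apply: leq_trans IH _; rewrite addnS.
move: E; rewrite /step; case: tm_delta => // -[q a] [<-] /=; rewrite ffunE.
move: IH; case: (cfg_tape _ _) => l y r /=; case: (a _) => z [] /=;
  by rewrite ?size_behead; lia.
Qed.

End HaltingTimes.

Section Bin.
Lemma bin_double k (b : bool) : (0 < k)%N -> bin (k.*2 + b) = rcons (bin k) b.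
Proof.
move=> k0; rewrite /bin trunc_log2S; last by case: b k0; lia.
have -> : (k.*2 + b)./2 = k by rewrite addnC half_bit_double.
rewrite -rev_cons; congr rev; rewrite /mkseq /= expn0 divn1 oddD odd_double oddb.
congr cons; rewrite -[1%N]addn0 iotaDl -map_comp; apply: eq_map => i /=.
by rewrite add1n expnS divnMA divn2 addnC half_bit_double.
Qed.
End Bin.

(** * The diagonal machine *)

Section Diagonal.
Variables U0 U : turing_machine.

(** The boolean replaces the missing conditional: a test sets it and guards a loop whose body clears
    it. It also carries the bit produced by [halve] and ends the search. *)
Definition memory : finType := (control U0 * control U * bool)%type.

Definition aux_sym : finType :=
  (option (bool + tm_aux U0) + option (bool + tm_aux U))%type.

Local Notation sym := (bool + aux_sym)%type.

Definition stack_name : finType :=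
  ('I_(tm_tapes U0).+1 * bool + 'I_(tm_tapes U).+1 * bool + 'I_10)%type.

Local Notation prog := (program memory aux_sym stack_name).

(* Bits are their own code, so that the input and the output of [U0] need no
   translation. *)
Definition enc0 (a : cell U0) : sym :=
  if a is Some (inl b) then inl b else inr (inl a).

Definition dec0 (s : sym) : cell U0 :=
  match s with inl b => Some (inl b) | inr (inl a) => a | _ => None end.

Definition enc1 (a : cell U) : sym :=
  if a is Some (inl b) then inl b else inr (inr a).

Definition dec1 (s : sym) : cell U :=
  match s with inl b => Some (inl b) | inr (inr a) => a | _ => None end.

Lemma enc0K : cancel enc0 dec0. Proof. by case=> [[]|]. Qed.
Lemma enc1K : cancel enc1 dec1. Proof. by case=> [[]|]. Qed.

(* [rho r] is the value of the unary counter number [r < 10]. *)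
Definition conc (c0 : config U0) (c : config U) (fl : bool) (rho : nat -> nat) :
    store memory aux_sym stack_name :=
  ((control_of c0, control_of c, fl), fun i : stack_name =>
    match i with
    | inl (inl (j, b)) => map enc0 (half_tape c0 j b)
    | inl (inr (j, b)) => map enc1 (half_tape c j b)
    | inr r => nseq (rho (val r)) (inl true)
    end).

Definition on_tapes0 (op : tape_op U0) : prog := Basic (fun q tp =>
  let r := op q.1.1 (fun i b => omap dec0 (tp (inl (inl (i, b))))) in
  ((r.1, q.1.2, q.2), fun i =>
    if i is inl (inl (j, b)) then omap (omap enc0) (r.2 j b) else None)).

Definition on_tapes1 (op : bool -> tape_op U) : prog := Basic (fun q tp =>
  let r := op q.2 q.1.2 (fun i b => omap dec1 (tp (inl (inr (i, b))))) in
  ((q.1.1, r.1, q.2), fun i =>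
    if i is inl (inr (j, b)) then omap (omap enc1) (r.2 j b) else None)).

Definition positive_counter (tp : stack_name -> option sym) (r : nat) : bool :=
  if insub r is Some j then isSome (tp (inr j)) else false.

(* In [on_counters], [Some true] increments a counter and [Some false]
   decrements it. *)
Definition on_counters
    (g : memory -> (nat -> bool) -> bool * (nat -> option bool)) : prog :=
  Basic (fun q tp =>
    let r := g q (positive_counter tp) in
    ((q.1, r.1), fun i => if i is inr j then
       omap (fun inc : bool => if inc then Some (inl true) else None) (r.2 (val j))
     else None)).

Definition change (o : option bool) (n : nat) : nat :=
  match o with None => n | Some true => n.+1 | Some false => n.-1 end.

Definition loop (b : memory -> (nat -> bool) -> bool) (c : prog) : prog :=
  While (fun q tp => b q (positive_counter tp)) c.

Lemma exec_eq (c : prog) s s1 s2 : exec c s s1 -> s1 = s2 -> exec c s s2.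
Proof. by move=> ? <-. Qed.

Lemma map_apply_op (T T' : Type) (f : T -> T') o s :
  map f (apply_op o s) = apply_op (omap (omap f) o) (map f s).
Proof. by case: o => [[a|]|] //=; case: s. Qed.

Lemma exec_on_tapes0 op c0 c0' c fl rho : performs op c0 c0' ->
  exec (on_tapes0 op) (conc c0 c fl rho) (conc c0' c fl rho).
Proof.
case=> h1 h2; apply: exec_eq (ExecBasic _ _) _; rewrite /apply_basic /=.
have topE : (fun i b => omap dec0 (tops (conc c0 c fl rho).2 (inl (inl (i, b)))))
    = (fun i b => ohead (half_tape c0 i b)).
  apply: funext => i; apply: funext => b; rewrite /tops /=.
  by case: half_tape => //= a l; rewrite enc0K.
rewrite topE h1; congr (_, _); apply: funext => -[[[j b]|[j b]]|r] //=.
by rewrite -h2 map_apply_op.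
Qed.

Lemma exec_on_tapes1 op c0 c c' fl rho : performs (op fl) c c' ->
  exec (on_tapes1 op) (conc c0 c fl rho) (conc c0 c' fl rho).
Proof.
case=> h1 h2; apply: exec_eq (ExecBasic _ _) _; rewrite /apply_basic /=.
have topE : (fun i b => omap dec1 (tops (conc c0 c fl rho).2 (inl (inr (i, b)))))
    = (fun i b => ohead (half_tape c i b)).
  apply: funext => i; apply: funext => b; rewrite /tops /=.
  by case: half_tape => //= a l; rewrite enc1K.
rewrite topE h1; congr (_, _); apply: funext => -[[[j b]|[j b]]|r] //=.
by rewrite -h2 map_apply_op.
Qed.

Lemma positive_conc c0 c fl rho :
  positive_counter (tops (conc c0 c fl rho).2) =
  (fun r => (r < 10)%N && (0 < rho r)%N).
Proof.
apply: funext => r; rewrite /positive_counter.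
case: insubP => [j rl <-|/negbTE -> //]; rewrite /tops /= ltn_ord.
by case: (rho j).
Qed.

Lemma exec_on_counters g c0 c fl rho :
  let r := g (control_of c0, control_of c, fl) (fun r => (r < 10)%N && (0 < rho r)%N) in
  exec (on_counters g) (conc c0 c fl rho)
    (conc c0 c r.1 (fun i => change (r.2 i) (rho i))).
Proof.
apply: exec_eq (ExecBasic _ _) _.
rewrite /apply_basic positive_conc /=; congr (_, _).
apply: funext => -[[[j b]|[j b]]|r] //=.
by case: (_.2 _) => [[]|] //=; case: (rho r).
Qed.

Lemma exec_loop n (b : memory -> (nat -> bool) -> bool) c
    (c0 : nat -> config U0) (c1 : nat -> config U) (fl : nat -> bool)
    (rho : nat -> nat -> nat) :
  (forall k, (k < n)%N ->
    b (control_of (c0 k), control_of (c1 k), fl k)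
      (fun r => (r < 10)%N && (0 < rho k r)%N) /\
    exec c (conc (c0 k) (c1 k) (fl k) (rho k))
      (conc (c0 k.+1) (c1 k.+1) (fl k.+1) (rho k.+1))) ->
  ~~ b (control_of (c0 n), control_of (c1 n), fl n)
      (fun r => (r < 10)%N && (0 < rho n r)%N) ->
  exec (loop b c) (conc (c0 0%N) (c1 0%N) (fl 0%N) (rho 0%N))
    (conc (c0 n) (c1 n) (fl n) (rho n)).
Proof.
move=> h1 h2.
apply: (exec_while_iter (s := fun k => conc (c0 k) (c1 k) (fl k) (rho k))) => [k kn|];
  rewrite positive_conc //.
exact: h1.
Qed.

Lemma exec_loop_true (b : memory -> (nat -> bool) -> bool) c c0 c1 fl rho s s' :
  b (control_of c0, control_of c1, fl) (fun r => (r < 10)%N && (0 < rho r)%N) ->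
  exec c (conc c0 c1 fl rho) s -> exec (loop b c) s s' ->
  exec (loop b c) (conc c0 c1 fl rho) s'.
Proof. by move=> h; apply: ExecWhileTrue; rewrite positive_conc. Qed.

Lemma exec_loop_false (b : memory -> (nat -> bool) -> bool) c c0 c1 fl rho :
  ~~ b (control_of c0, control_of c1, fl) (fun r => (r < 10)%N && (0 < rho r)%N) ->
  exec (loop b c) (conc c0 c1 fl rho) (conc c0 c1 fl rho).
Proof. by move=> h; apply: ExecWhileFalse; rewrite positive_conc. Qed.

(** * Arithmetic on unary counters *)

Definition transfer (i : nat) (js : seq nat) : prog :=
  loop (fun _ nz => nz i) (on_counters (fun q _ => (q.2, fun r =>
    if r == i then Some false else if r \in js then Some true else None))).

Lemma exec_transfer i js {c0 c fl rho rho'} : (i < 10)%N ->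
  (forall r, rho' r =
    if r == i then 0%N else if r \in js then (rho r + rho i)%N else rho r) ->
  exec (transfer i js) (conc c0 c fl rho) (conc c0 c fl rho').
Proof.
move=> i10 rho'E.
pose s k r := if r == i then (rho i - k)%N else
  if r \in js then (rho r + k)%N else rho r.
have -> : rho = s 0%N.
  by apply: funext => r; rewrite /s subn0 addn0 if_same; case: eqP => [->|].
have -> : rho' = s (rho i).
  by apply: funext => r; rewrite rho'E /s subnn.
apply: (exec_loop (c0 := fun=> c0) (c1 := fun=> c) (fl := fun=> fl)) => [k kn|].
  split; first by rewrite i10 /s eqxx subn_gt0.
  apply: exec_eq (exec_on_counters _ _ _ _ _) _ => /=; congr conc.
  apply: funext => r; rewrite /s; case: eqP => _ /=; first by rewrite subnS.
  by case: ifP => //= _; rewrite addnS.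
by rewrite /s eqxx subnn andbF.
Qed.

(** Reading a counter empties it, so its value also goes to a scratch counter [k], from which it is
    restored. *)
Definition copy (i j k : nat) : prog := Seq (transfer i [:: j; k]) (transfer k [:: i]).

Lemma exec_copy i j k {c0 c fl rho rho'} : (i < 10)%N -> (k < 10)%N ->
  uniq [:: i; j; k] -> rho k = 0%N ->
  (forall r, rho' r = if r == j then (rho j + rho i)%N else rho r) ->
  exec (copy i j k) (conc c0 c fl rho) (conc c0 c fl rho').
Proof.
move=> i10 k10; rewrite /= !inE !negb_or => /and3P [/andP [ij ik] jk _] rk rho'E.
apply: ExecSeq; first by apply: exec_transfer => // r; reflexivity.
apply: exec_transfer => // r; rewrite rho'E !inE eqxx orbT rk.
rewrite [k == i]eq_sym (negbTE ik).
case: (r =P k) => [->|_]; first by rewrite eq_sym (negbTE jk).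
case: (r =P i) => [->|_]; first by rewrite (negbTE ij).
by rewrite orbF; case: eqP => [->|].
Qed.

Definition mulacc (i j k l : nat) : prog :=
  loop (fun _ nz => nz i) (Seq (on_counters (fun q _ => (q.2, fun r =>
    if r == i then Some false else None))) (copy j k l)).

Lemma exec_mulacc i j k l {c0 c fl rho rho'} : (i < 10)%N -> (j < 10)%N -> (l < 10)%N ->
  uniq [:: i; j; k; l] -> rho l = 0%N ->
  (forall r, rho' r = if r == i then 0%N
    else if r == k then (rho k + rho i * rho j)%N else rho r) ->
  exec (mulacc i j k l) (conc c0 c fl rho) (conc c0 c fl rho').
Proof.
move=> i10 j10 l10; rewrite cons_uniq !inE !negb_or => /andP [/and3P [ij ik il]].
move=> ujkl rl rho'E.
pose s m r := if r == i then (rho i - m)%N else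
  if r == k then (rho k + m * rho j)%N else rho r.
have -> : rho = s 0%N.
  apply: funext => r; rewrite /s subn0 mul0n addn0.
  by case: eqP => [->//|_]; case: eqP => [->|].
have -> : rho' = s (rho i) by apply: funext => r; rewrite rho'E /s subnn.
apply: (exec_loop (c0 := fun=> c0) (c1 := fun=> c) (fl := fun=> fl)) => [m mn|].
  split; first by rewrite i10 /s eqxx subn_gt0.
  apply: ExecSeq; first exact: exec_on_counters.
  rewrite /=; apply: exec_copy => //=.
    have kl : (l == k) = false.
      by apply/eqP => e; move: ujkl; rewrite e /= !inE !eqxx /= !andbF.
    by rewrite [l == i]eq_sym (negbTE il) /s [l == i]eq_sym (negbTE il) /= kl.
  have jk : (j == k) = false.
    by apply/eqP => e; move: ujkl; rewrite e /= !inE eqxx.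
  move=> r; rewrite /s ![_ == i]eq_sym (negbTE ik) (negbTE ij) jk eqxx /=.
  case: (eqVneq i r) => [<-|ir] /=; first by rewrite (negbTE ik) subnS.
  by case: eqP => // _; rewrite mulSn; lia.
by rewrite /s eqxx subnn andbF.
Qed.

Local Notation "c1 ;; c2" := (Seq c1 c2) (at level 61, right associativity).

Definition step_counters (incs decs : seq nat) : prog :=
  on_counters (fun q _ => (q.2, fun r =>
    if r \in incs then Some true else if r \in decs then Some false else None)).

Definition set_flag (b : memory -> (nat -> bool) -> bool) : prog :=
  on_counters (fun q nz => (b q nz, fun=> None)).

Lemma exec_step_counters incs decs {c0 c fl rho rho'} :
  (forall r, rho' r = if r \in incs then (rho r).+1
                      else if r \in decs then (rho r).-1 else rho r) ->
  exec (step_counters incs decs) (conc c0 c fl rho) (conc c0 c fl rho').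
Proof.
move=> rho'E; apply: exec_eq (exec_on_counters _ _ _ _ _) _ => /=; congr conc.
by apply: funext => r; rewrite rho'E; do 2?case: ifP.
Qed.

Lemma exec_set_flag b {c0 c fl fl' rho} :
  fl' = b (control_of c0, control_of c, fl) (fun r => (r < 10)%N && (0 < rho r)%N) ->
  exec (set_flag b) (conc c0 c fl rho) (conc c0 c fl' rho).
Proof. by move=> ->; exact: exec_on_counters. Qed.

(* Counter 0 is [v], 1 is [P = 2 ^ m], 2 is the stage [t], 3 is [n], 4 and 5 are
   the numerator and denominator of the partial sum, 6 to 9 are scratch. *)
Definition regs (l : seq nat) (r : nat) : nat := nth 0%N l r.

Ltac by_regs := do 10?[case; first by rewrite /regs /= ?inE //=; lia];
  by move=> r; rewrite /regs /= ?inE.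

(** The flag is the parity of the number of units removed: counter 7 grows at every second round,
    and the flag ends as the remainder. *)
Definition halve : prog :=
  loop (fun _ nz => nz 6) (on_counters (fun q _ => (~~ q.2, fun r =>
    if r == 6 then Some false else if (r == 7) && q.2 then Some true else None))).

Lemma exec_halve v P t n a b e c0 c :
  exec halve (conc c0 c false (regs [:: v; P; t; n; a; b; e]))
    (conc c0 c (odd e) (regs [:: v; P; t; n; a; b; 0; e./2])%N).
Proof.
pose s k := regs [:: v; P; t; n; a; b; e - k; k./2]%N.
have -> : regs [:: v; P; t; n; a; b; e] = s 0%N.
  by apply: funext; rewrite /s subn0; by_regs.
have -> : regs [:: v; P; t; n; a; b; 0; e./2]%N = s e by rewrite /s subnn.
apply: (exec_loop (c0 := fun=> c0) (c1 := fun=> c) (fl := odd)) => [k kn|].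
  split; first by rewrite /= subn_gt0.
  apply: exec_eq (exec_on_counters _ _ _ _ _) _ => /=; congr conc.
  by apply: funext; rewrite /s; case: (boolP (odd k)) => ok; by_regs.
by rewrite /s /= subnn.
Qed.

(* Counter 6 holds [n - 1]: with [n = 2k + d], removing 1 from it and halving
   gives [k - 1], with remainder [d]. *)
Definition push_bin : prog :=
  loop (fun _ nz => nz 6)
    (step_counters [::] [:: 6] ;; set_flag (fun _ _ => false) ;; halve ;;
     on_tapes1 (fun fl => push_op (bit U fl)) ;; transfer 7 [:: 6])%N.

(** The bits appear least significant first and each is pushed in front of the others, hence the
    accumulator [s]; the loop stops at the leading 1, which [bin] omits. *)
Lemma exec_push_bin v P t n a b e c0 s fl : exists fl',
  exec push_bin
    (conc c0 (loaded U s) fl (regs [:: v; P; t; n; a; b; e]))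
    (conc c0 (loaded U (bin e.+1 ++ s)) fl' (regs [:: v; P; t; n; a; b])).
Proof.
elim/ltn_ind: e s fl => -[|e] IH s fl.
  exists fl; have -> : regs [:: v; P; t; n; a; b; 0]%N = regs [:: v; P; t; n; a; b].
    by apply: funext; by_regs.
  exact: exec_loop_false.
have [] := IH e./2 _ (odd e :: s) (odd e); first by rewrite ltnS leq_half_double; lia.
move=> fl' h; exists fl'; apply: exec_loop_true => //; last first.
  have -> : bin e.+2 = rcons (bin e./2.+1) (odd e).
    have -> : e.+2 = (e./2.+1.*2 + odd e)%N by lia.
    exact: bin_double.
  by rewrite cat_rcons; exact: h.
apply: ExecSeq.
  by apply: (exec_step_counters (rho' := regs [:: v; P; t; n; a; b; e])); by_regs.
apply: ExecSeq; first by apply: (exec_set_flag (fl' := false)).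
apply: ExecSeq; first exact: exec_halve.
apply: ExecSeq; first by apply: exec_on_tapes1; exact: push_opP.
by rewrite pushed_loaded; apply: exec_transfer => //; by_regs.
Qed.

(** * Simulation of [U] and the partial sums *)

Definition clear : prog :=
  Seq (While (fun _ tp => [exists ib, isSome (tp (inl (inr ib)))])
         (on_tapes1 (fun _ => @pop_op U)))
      (on_tapes1 (fun _ => @reset_op U)).

Lemma exec_clear c0 c fl rho :
  exec clear (conc c0 c fl rho) (conc c0 (loaded U [::]) fl rho).
Proof.
(* Each round pops every half tape, so the longest one bounds the number of rounds. *)
have [N] : exists N, forall i b, (size (half_tape c i b) <= N)%N.
  exists (\max_(ib : 'I_(tm_tapes U).+1 * bool) size (half_tape c ib.1 ib.2)).
  move=> i b.
  by rewrite (leq_bigmax (F := fun ib => size (half_tape c ib.1 ib.2)) (i, b)).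
elim: N c => [|N IH] c hN.
  have ce i b : half_tape c i b = [::] by apply/nilP; rewrite /nilp -leqn0.
  apply: ExecSeq; last by apply: exec_on_tapes1; exact: reset_opP.
  by apply: ExecWhileFalse; apply/existsPn => -[i b]; rewrite /tops /= ce.
have [hs|hs] := boolP [exists ib, isSome (tops (conc c0 c fl rho).2 (inl (inr ib)))].
  have : forall i b, (size (half_tape (popped c) i b) <= N)%N.
    move=> i b; have [_ <-] := pop_opP c.
    by rewrite /= size_behead; move: (hN i b); lia.
  move=> /IH h; inversion_clear h.
  apply: ExecSeq H0; apply: ExecWhileTrue H => //.
  by apply: exec_on_tapes1; exact: pop_opP.
apply: ExecSeq; first exact: ExecWhileFalse.
apply: exec_on_tapes1; apply: reset_opP => i b.
by move/existsPn: hs => /(_ (i, b)); rewrite /tops /=; case: half_tape.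
Qed.

Definition simulate : prog :=
  loop (fun q nz => nz 6 && ~~ halted q.1.2)
    (on_tapes1 (fun _ => @step_op U) ;; step_counters [::] [:: 6])%N.

(** Counter 6 is the budget of steps. An early halt leaves an amount [x'] of it, which the caller
    discards. *)
Lemma exec_simulate v P t n a b x c0 c fl : exists x',
  exec simulate (conc c0 c fl (regs [:: v; P; t; n; a; b; x]))
    (conc c0 (stutter c x) fl (regs [:: v; P; t; n; a; b; x'])).
Proof.
elim: x c => [|x IH] c; first by exists 0%N; apply: exec_loop_false.
case E: (step c) => [c'|]; last first.
  exists x.+1; rewrite stutter_halted //; apply: exec_loop_false.
  by rewrite /= halted_control E.
have [x' h] := IH c'; exists x'; rewrite /stutter iterSr E.
apply: exec_loop_true h; first by rewrite /= halted_control E.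
apply: ExecSeq; first by apply: exec_on_tapes1; exact: (step_opP E).
by apply: exec_step_counters; by_regs.
Qed.

Definition halts_by (t n : nat) : bool := ~~ isSome (step (stutter (init U (bin n)) t)).

(* [(a, b)] stands for the fraction [a / b], to which [1 / n] is added. *)
Definition add_term (t n : nat) (ab : nat * nat) : nat * nat :=
  if halts_by t n then (ab.1 * n + ab.2, ab.2 * n)%N else ab.

Fixpoint add_terms (t n : nat) (ab : nat * nat) : nat * nat :=
  if n is n'.+1 then add_terms t n' (add_term t n ab) else ab.

Definition process : prog :=
  (clear ;; copy 3 6 7 ;; step_counters [::] [:: 6] ;; push_bin ;;
   on_tapes1 (fun _ => @advance_op U) ;; copy 2 6 7 ;; simulate ;; transfer 6 [::] ;;
   set_flag (fun q _ => halted q.1.2) ;;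
   loop (fun q _ => q.2)
     (set_flag (fun _ _ => false) ;; mulacc 4 3 6 9 ;; transfer 5 [:: 4; 8] ;;
      mulacc 8 3 5 9 ;; transfer 6 [:: 4]) ;;
   step_counters [::] [:: 3])%N.

Lemma exec_process v P t n a b c0 c fl : exists c',
  let ab := add_term t n.+1 (a, b) in
  exec process (conc c0 c fl (regs [:: v; P; t; n.+1; a; b]))
    (conc c0 c' false (regs [:: v; P; t; n; ab.1; ab.2])).
Proof.
have [fl1 h1] := exec_push_bin v P t n.+1 a b n c0 [::] fl.
have [x2 h2] := exec_simulate v P t n.+1 a b t c0 (init U (bin n.+1)) fl1.
exists (stutter (init U (bin n.+1)) t) => ab; rewrite /process.
apply: ExecSeq; first exact: exec_clear.
apply: ExecSeq.
  by apply: (exec_copy (rho' := regs [:: v; P; t; n.+1; a; b; n.+1])) => //; by_regs.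
apply: ExecSeq.
  by apply: (exec_step_counters (rho' := regs [:: v; P; t; n.+1; a; b; n])); by_regs.
apply: ExecSeq; first exact: h1.
rewrite cats0.
apply: ExecSeq; first by apply: exec_on_tapes1; exact: advance_opP.
rewrite advance_loaded.
apply: ExecSeq.
  by apply: (exec_copy (rho' := regs [:: v; P; t; n.+1; a; b; t])) => //; by_regs.
apply: ExecSeq; first exact: h2.
apply: ExecSeq.
  by apply: (exec_transfer (rho' := regs [:: v; P; t; n.+1; a; b])) => //; by_regs.
apply: ExecSeq.
  by apply: (exec_set_flag (fl' := halts_by t n.+1)); rewrite halted_control.
apply: (ExecSeq (s2 := conc c0 (stutter (init U (bin n.+1)) t) false
  (regs [:: v; P; t; n.+1; ab.1; ab.2]))); last by apply: exec_step_counters; by_regs.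
rewrite /ab /add_term; case: ifP => ht; last exact: exec_loop_false.
apply: exec_loop_true => //; last exact: exec_loop_false.
apply: ExecSeq; first by apply: (exec_set_flag (fl' := false)).
apply: ExecSeq.
  apply: (exec_mulacc (rho' := regs [:: v; P; t; n.+1; 0; b; a * n.+1]%N)) => //; by_regs.
apply: ExecSeq.
  by apply: (exec_transfer
    (rho' := regs [:: v; P; t; n.+1; b; 0; a * n.+1; 0; b]%N)) => //; by_regs.
apply: ExecSeq.
  by apply: (exec_mulacc
    (rho' := regs [:: v; P; t; n.+1; b; b * n.+1; a * n.+1]%N)) => //; by_regs.
by apply: exec_transfer => //; by_regs.
Qed.

(** Incrementing counter 5 along with [t] resets the fraction to [0 / 1]: the comparison of the
    previous stage has consumed both its numerator and its denominator. *)
Definition stage : prog :=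
  (step_counters [:: 2; 5] [::] ;; copy 2 3 6 ;; loop (fun _ nz => nz 3) process ;;
   mulacc 4 1 6 9 ;; mulacc 5 0 7 9 ;;
   loop (fun _ nz => nz 6 && nz 7) (step_counters [::] [:: 6; 7]) ;;
   set_flag (fun _ nz => nz 6) ;; transfer 6 [::] ;; transfer 7 [::])%N.

Definition exceeds (v P t : nat) : bool :=
  let ab := add_terms t t (0, 1)%N in (v * ab.2 < ab.1 * P)%N.

Lemma exec_stage v P t c0 c : exists c',
  exec stage (conc c0 c false (regs [:: v; P; t]))
    (conc c0 c' (exceeds v P t.+1) (regs [:: v; P; t.+1])).
Proof.
have [c1] : exists c1, let ab := add_terms t.+1 t.+1 (0, 1)%N in
    exec (loop (fun _ nz => nz 3%N) process)
      (conc c0 c false (regs [:: v; P; t.+1; t.+1; 0; 1]%N))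
      (conc c0 c1 false (regs [:: v; P; t.+1; 0; ab.1; ab.2]%N)).
  move: {2 4}t.+1 => n.
  suff: forall a b, exists c1, let ab := add_terms t.+1 n (a, b)%N in
    exec (loop (fun _ nz => nz 3%N) process)
      (conc c0 c false (regs [:: v; P; t.+1; n; a; b]%N))
      (conc c0 c1 false (regs [:: v; P; t.+1; 0; ab.1; ab.2]%N)) by apply.
  elim: n c => [|n IH] c' a b; first by exists c'; exact: exec_loop_false.
  have [c2 h2] := exec_process v P t.+1 n a b c0 c' false.
  have [c1] := IH c2 (add_term t.+1 n.+1 (a, b)).1 (add_term t.+1 n.+1 (a, b)).2.
  rewrite -surjective_pairing => h1; exists c1.
  exact: exec_loop_true h2 h1.
rewrite /exceeds; case: (add_terms _ _ _) => a b /= h1; exists c1.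
apply: ExecSeq.
  by apply: (exec_step_counters (rho' := regs [:: v; P; t.+1; 0; 0; 1]%N)); by_regs.
apply: ExecSeq.
  by apply: (exec_copy (rho' := regs [:: v; P; t.+1; t.+1; 0; 1]%N)) => //; by_regs.
apply: ExecSeq; first exact: h1.
apply: ExecSeq.
  by apply: (exec_mulacc (rho' := regs [:: v; P; t.+1; 0; 0; b; a * P]%N)) => //; by_regs.
apply: ExecSeq.
  by apply: (exec_mulacc
    (rho' := regs [:: v; P; t.+1; 0; 0; 0; a * P; b * v]%N)) => //; by_regs.
(* Both products decrease together until one vanishes; something remains of [a * P] exactly when it
   was the larger. *)
pose s k := regs [:: v; P; t.+1; 0; 0; 0; a * P - k; b * v - k]%N.
apply: (ExecSeq (s2 := conc c0 c1 false (s (minn (a * P) (b * v))))).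
  have -> : regs [:: v; P; t.+1; 0; 0; 0; a * P; b * v]%N = s 0%N.
    by rewrite /s !subn0.
  apply: (exec_loop (c0 := fun=> c0) (c1 := fun=> c1) (fl := fun=> false)) => [k kn|].
    split; first by rewrite /= !subn_gt0; lia.
    by apply: exec_step_counters; rewrite /s; by_regs.
  by rewrite /s /= !subn_gt0; lia.
apply: ExecSeq.
  by apply: (exec_set_flag (fl' := (v * b < a * P)%N)); rewrite /s /=; lia.
apply: ExecSeq.
  apply: (exec_transfer (rho' := regs [:: v; P; t.+1; 0; 0; 0; 0;
    b * v - minn (a * P) (b * v)]%N)) => //; rewrite /s; by_regs.
by apply: exec_transfer => //; by_regs.
Qed.

Definition search : prog := loop (fun q _ => ~~ q.2) stage.

Lemma exec_search v P c0 c : (exists t, exceeds v P t.+1) -> exists t c',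
  exceeds v P t /\
  exec search (conc c0 c false (regs [:: v; P])) (conc c0 c' true (regs [:: v; P; t])).
Proof.
move=> ex; case: (ex_minnP ex) => k hk kmin; exists k.+1.
suff [c' h] : exists c', exec search (conc c0 c false (regs [:: v; P; 0]%N))
    (conc c0 c' true (regs [:: v; P; k.+1])).
  exists c'; split=> //; have -> // : regs [:: v; P] = regs [:: v; P; 0]%N.
  by apply: funext; by_regs.
have {ex} hmin j : (j < k)%N -> ~~ exceeds v P j.+1.
  by move=> jk; apply/negP => /kmin; lia.
suff h d : (d <= k)%N -> forall c, exists c',
    exec search (conc c0 c false (regs [:: v; P; k - d]%N))
      (conc c0 c' true (regs [:: v; P; k.+1])).
  by have := h k (leqnn k) c; rewrite subnn.
elim: d => [|d IH] dk c1.
  have [c2 h] := exec_stage v P k c0 c1.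
  exists c2; rewrite subn0; rewrite hk in h.
  by apply: (exec_loop_true _ h) => //; apply: exec_loop_false.
have [c2 h] := exec_stage v P (k - d.+1) c0 c1.
have dkE : ((k - d.+1).+1 = k - d)%N by lia.
have [c' h'] := IH (ltnW dk) c2; exists c'; apply: (exec_loop_true _ h) => //.
by rewrite (negbTE (hmin _ _)) dkE //; lia.
Qed.

(** Started at 0 this is the binary value of a word; started at 1, which restores the leading bit,
    it is the number whose [bin] is that word. *)
Definition bit_value : seq bool -> nat -> nat :=
  fun s v => foldl (fun v (b : bool) => v.*2 + b)%N v s.

Definition under_head (q : memory) : cell U0 := q.1.1.2 ord0.

Definition read_output : prog :=
  loop (fun q _ => if under_head q is Some (inl _) then true else false)
    (transfer 0 [:: 6; 7] ;; transfer 6 [:: 0] ;; transfer 7 [:: 0] ;;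
     on_counters (fun q _ => (q.2, fun r =>
       if (r == 0) && (under_head q == bit U0 true) then Some true else None)) ;;
     transfer 1 [:: 6; 7] ;; transfer 6 [:: 1] ;; transfer 7 [:: 1] ;;
     on_tapes0 (@advance_op U0))%N.

Lemma exec_read_output s c0 c fl v P : output c0 = s -> exists c0',
  exec read_output (conc c0 c fl (regs [:: v; P]))
    (conc c0' c fl (regs [:: bit_value s v; P * 2 ^ size s]%N)).
Proof.
elim: s c0 v P => [|b s IH] c0 v P.
  move=> h; exists c0; rewrite muln1; apply: exec_loop_false.
  by move: h; rewrite /output /under_head /= ffunE; case: (tape_cur _) => [[]|].
rewrite /output /=; case E: (tape_cur _) => [[b'|]|] // [eb hs].
have [|c0' h] := IH (advance c0) (v.*2 + b)%N P.*2.
  by rewrite /output /advance /= !ffunE /= -hs; case: (tape_right _).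
exists c0'; rewrite /= expnS mulnCA mulnA mul2n.
apply: exec_loop_true h; first by rewrite /under_head /= ffunE E.
apply: ExecSeq.
  by apply: (exec_transfer (rho' := regs [:: 0; P; 0; 0; 0; 0; v; v]%N)) => //; by_regs.
apply: ExecSeq.
  by apply: (exec_transfer (rho' := regs [:: v; P; 0; 0; 0; 0; 0; v]%N)) => //; by_regs.
apply: ExecSeq.
  by apply: (exec_transfer (rho' := regs [:: v.*2; P]%N)) => //; by_regs.
apply: (ExecSeq (s2 := conc c0 c fl (regs [:: v.*2 + b; P]%N))).
  apply: exec_eq (exec_on_counters _ _ _ _ _) _ => /=; congr conc.
  rewrite /under_head /= ffunE E eb; apply: funext.
  by clear; case: b => /=; by_regs.
apply: ExecSeq.
  by apply: (exec_transfer
    (rho' := regs [:: v.*2 + b; 0; 0; 0; 0; 0; P; P]%N)) => //; by_regs.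
apply: ExecSeq.
  by apply: (exec_transfer
    (rho' := regs [:: v.*2 + b; P; 0; 0; 0; 0; 0; P]%N)) => //; by_regs.
apply: ExecSeq.
  by apply: (exec_transfer (rho' := regs [:: v.*2 + b; P.*2]%N)) => //; by_regs.
by apply: exec_on_tapes0; exact: advance_opP.
Qed.

(* The blank separates the output from what [U0] has left on its tape. *)
Definition write_ones : prog :=
  (transfer 2 [:: 6; 7] ;; transfer 7 [:: 6] ;; step_counters [:: 6] [::] ;;
   on_tapes0 (push_op (blank U0)) ;;
   loop (fun _ nz => nz 6)
     (on_tapes0 (push_op (bit U0 true)) ;; step_counters [::] [:: 6]))%N.

Definition main_stack : stack_name := inl (inl (ord0, true)).

Lemma exec_write_ones v P t c0 c fl : exists2 s,
  exec write_ones (conc c0 c fl (regs [:: v; P; t])) s &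
  leading_bools (s.2 main_stack) = nseq t.*2.+1 true.
Proof.
pose d k := iter k (pushed (bit U0 true)) (pushed (blank U0) c0).
pose s k := regs [:: v; P; 0; 0; 0; 0; t.*2.+1 - k]%N.
exists (conc (d t.*2.+1) c fl (s t.*2.+1)).
  apply: ExecSeq.
    by apply: (exec_transfer (rho' := regs [:: v; P; 0; 0; 0; 0; t; t]%N)) => //; by_regs.
  apply: ExecSeq.
    by apply: (exec_transfer (rho' := regs [:: v; P; 0; 0; 0; 0; t.*2]%N)) => //; by_regs.
  apply: ExecSeq.
    by apply: (exec_step_counters (rho' := s 0%N)) => //; rewrite /s; by_regs.
  apply: ExecSeq; first by apply: exec_on_tapes0; exact: push_opP.
  apply: (exec_loop (c0 := d) (c1 := fun=> c) (fl := fun=> fl)) => [k kn|].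
    split; first by rewrite /= subn_gt0.
    apply: ExecSeq; first by apply: exec_on_tapes0; exact: push_opP.
    by apply: exec_step_counters; rewrite /s; by_regs.
  by rewrite /s /= subnn.
suff h k : leading_bools (map enc0 (half_tape (d k) ord0 true)) = nseq k true by exact: h.
elim: k => [|k IH]; first by rewrite /d /half_tape /= ffunE.
by rewrite /half_tape /= ffunE /= -IH.
Qed.

Definition run_U0 : prog :=
  loop (fun q _ => ~~ halted q.1.1) (on_tapes0 (@step_op U0)).

Definition diagonal : prog :=
  (on_tapes0 (@advance_op U0) ;; run_U0 ;; step_counters [:: 1] [::] ;; read_output ;;
   search ;; write_ones)%N.

Definition start_memory : memory :=
  (control_of (loaded U0 [::]), control_of (loaded U [::]), false).

Definition diagonal_machine : turing_machine :=
  stack_machine main_stack diagonal start_memory.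

Lemma input_store_conc x :
  input_store _ main_stack start_memory x =
  conc (loaded U0 x) (loaded U [::]) false (regs [::]).
Proof.
congr (_, _).
  by congr (_, _, _); congr (_, _); apply/ffunP => i; rewrite !ffunE.
apply: funext => -[[[j b]|[j b]]|r] /=; rewrite /half_tape /= ?ffunE /=.
- rewrite -[_ == main_stack]/((j == ord0) && (b == true)).
  by case: b; rewrite ?andbT ?andbF //; case: eqP => // _; rewrite -map_comp.
- by rewrite if_same; case: b.
- by rewrite /regs nth_nil.
Qed.

Lemma exec_run_U0 t c0 c0' c fl rho :
  iter t (obind (@step U0)) (Some c0) = Some c0' -> step c0' = None ->
  exec run_U0 (conc c0 c fl rho) (conc c0' c fl rho).
Proof.
elim: t c0 => [|t IH] c0.
  by move=> [->] h; apply: exec_loop_false; rewrite /= halted_control h.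
rewrite iterSr /=; case E: (step c0) => [c1|]; last first.
  by have -> : iter t (obind (@step U0)) None = None by elim: t {IH} => //= t ->.
move=> h1 h2; apply: exec_loop_true (IH _ h1 h2); first by rewrite /= halted_control E.
by apply: exec_on_tapes0; exact: (step_opP E).
Qed.

Lemma diagonal_computes w s : computes U0 w s ->
  (exists t, exceeds (bit_value s 0) (2 ^ size s) t.+1) ->
  exists2 t, exceeds (bit_value s 0) (2 ^ size s) t &
    computes diagonal_machine w (nseq t.*2.+1 true).
Proof.
move=> [k [c0 [it h out]]] ex.
have [c1 h1] := exec_read_output (loaded U [::]) false 0 1 out.
have [t [c2 [ht h2]]] := exec_search c1 (loaded U [::]) ex.
have [e h3 he] := exec_write_ones (bit_value s 0) (2 ^ size s) t c1 c2 true.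
exists t => //; apply/stack_machine_computes; exists e => //.
rewrite input_store_conc.
apply: ExecSeq; first by apply: exec_on_tapes0; exact: advance_opP.
rewrite advance_loaded; apply: ExecSeq; first exact: exec_run_U0 it h.
apply: ExecSeq; first by apply: (exec_step_counters (rho' := regs [:: 0; 1]%N)); by_regs.
apply: ExecSeq; first exact: h1.
by rewrite mul1n; apply: ExecSeq h3.
Qed.

Lemma exec_run_U0_inv c0 c fl rho s : exec run_U0 (conc c0 c fl rho) s ->
  exists t c0', iter t (obind (@step U0)) (Some c0) = Some c0' /\ step c0' = None.
Proof.
move e1: run_U0 => p; move e2: (conc _ _ _ _) => s1 h.
elim: h c0 e1 e2 => // [b b' s2 s3 s4 hb h1 _ h2 IH|b b' s2 hb] c0 [eb eb'] es; subst.
  move: hb; rewrite /= halted_control negbK; case E: (step c0) => [c1|] // _.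
  have e3 : conc c1 c fl rho = s3.
    apply: exec_det h1; apply: exec_on_tapes0; exact: (step_opP E).
  have [t [c0' [h3 h4]]] := IH c1 erefl e3.
  by exists t.+1, c0'; rewrite iterSr /= E.
exists 0%N, c0; split=> //.
by move: hb; rewrite /= halted_control negbK; case: step.
Qed.

(** The simulation of [U0] comes first and must end for the machine to halt, so prefix-freeness is
    inherited from [U0]. *)
Lemma dom_diagonal w : dom diagonal_machine w -> dom U0 w.
Proof.
case=> y /stack_machine_computes [s + _]; rewrite input_store_conc => h.
inversion_clear h; inversion_clear H0.
have e : conc (init U0 w) (loaded U [::]) false (regs [::]) = s2.
  apply: exec_det H; rewrite -advance_loaded.
  by apply: exec_on_tapes0; exact: advance_opP.
rewrite -e in H1; have [t [c [h1 h2]]] := exec_run_U0_inv H1.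
by exists (output c), t, c.
Qed.

End Diagonal.

(** * Bounds on the zeta number *)

Section TwoOutputs.

(** The loop changes nothing, so it never ends on a nonempty input: the domain is reduced to the
    empty word and is thus prefix-free. *)
Definition constant_program (x : bool) : program unit unit unit :=
  Seq (While (fun _ tp => isSome (tp tt)) (Basic (fun q _ => (q, fun=> None))))
    (Basic (fun q _ => (q, fun=> if x then Some (Some (inl true)) else None))).

Definition constant_machine (x : bool) : turing_machine :=
  stack_machine tt (constant_program x) tt.

Lemma constant_machine_computes x : computes (constant_machine x) [::] (nseq x true).
Proof.
apply/stack_machine_computes; eexists; last first; last first.
  by apply: ExecSeq; [apply: ExecWhileFalse|apply: ExecBasic].
by case: x.
Qed.

Lemma constant_machine_dom x w : dom (constant_machine x) w -> w = [::].
Proof.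
case=> y /stack_machine_computes [s h _]; move: h.
set s0 := input_store _ _ _ _ => h; inversion_clear h.
have : isSome (tops s0.2 tt) = false.
  move: H; set p := While _ _; have [c e] : exists c, c = p by exists p.
  rewrite -e => h.
  elim: h e => // [b c1 s1 s3 s4 bs h1 _ h2 IH|b c1 s1 hs] [eb ec]; subst.
    by inversion h1; subst; move: bs; have /= := IH erefl; rewrite /tops /= => ->.
  exact: negbTE.
by case: w @s0 H => [|a l] //=.
Qed.

Lemma constant_machine_self_delimiting x : self_delimiting (constant_machine x).
Proof. by move=> u v /constant_machine_dom -> /constant_machine_dom ->. Qed.

Lemma universal_two_programs U : universal U ->
  exists p q, [/\ dom U p, dom U q & p != q].
Proof.
case=> _ hU.
have get (x : bool) : exists p, computes U p (nseq x true).
  have [c /(_ _ _ (constant_machine_computes x)) [p _ hp]] :=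
    hU _ (@constant_machine_self_delimiting x).
  by exists p.
have [[p hp] [q hq]] := (get true, get false); exists p, q.
split; [by exists (nseq true true)|by exists (nseq false true)|].
apply/eqP => e; rewrite -e in hq.
by have := computes_inj hp hq.
Qed.

(** The empty word is a prefix of every other, so it would be the only program, while two outputs
    take two programs. Its term [1/1] would push the zeta number out of (0, 1). *)
Lemma universal_dom_nil U : universal U -> ~ dom U [::].
Proof.
move=> hU d0; have [p [q [dp dq]]] := universal_two_programs hU.
by rewrite -(hU.1 _ _ d0 dp (prefix0s p)) -(hU.1 _ _ d0 dq (prefix0s q)) eqxx.
Qed.

End TwoOutputs.

(** * Kraft's inequality on the binary heap *)

Section HeapSums.
Local Open Scope ring_scope.
Variables (R : realType) (D : set (seq bool)).
Hypothesis prefix_free : forall x y, D x -> D y -> prefix x y -> x = y.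

Definition term (n : nat) : R := if `[<D (bin n)>] then n%:R^-1 else 0.

Lemma term_ge0 n : 0 <= term n.
Proof. by rewrite /term; case: ifP. Qed.

Lemma bin_heap n j i : (0 < n)%N -> (n * 2 ^ j <= i < n.+1 * 2 ^ j)%N ->
  prefix (bin n) (bin i) /\ size (bin i) = (size (bin n) + j)%N.
Proof.
move=> n0; elim: j i => [|j IH] i.
  rewrite !muln1 ltnS => /andP [h1 h2]; have -> : i = n by lia.
  by rewrite prefix_refl addn0.
rewrite expnS => hi; have hi2 : (n * 2 ^ j <= i./2 < n.+1 * 2 ^ j)%N by lia.
have [p s] := IH _ hi2; have i0 : (0 < i./2)%N.
  by case/andP: hi2 => + _; apply: leq_trans; rewrite muln_gt0 n0 expn_gt0.
rewrite -[i]odd_double_half addnC bin_double // size_rcons s addnS; split=> //.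
by case/prefixP: p => u ->; rewrite -cats1 -catA; apply: prefix_prefix.
Qed.

(** The interval consists of the descendants of [n] at depth [j] in the heap where [n] has children
    [2n] and [2n+1]. *)
Definition level (n j : nat) : R := \sum_(n * 2 ^ j <= i < n.+1 * 2 ^ j) term i.

Definition subtree (n d : nat) : R := \sum_(j < d) level n j.

Lemma level0 n : level n 0 = term n.
Proof. by rewrite /level !muln1 big_nat1. Qed.

Lemma levelS n j : level n j.+1 = level n.*2 j + level n.*2.+1 j.
Proof.
have e1 : (n * 2 ^ j.+1 = n.*2 * 2 ^ j)%N by rewrite expnS; lia.
have e2 : (n.+1 * 2 ^ j.+1 = n.*2.+2 * 2 ^ j)%N by rewrite expnS; lia.
by rewrite /level e1 e2 -big_cat_nat // leq_mul2r leqnSn orbT.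
Qed.

Lemma subtreeS n d : subtree n d.+1 = term n + subtree n.*2 d + subtree n.*2.+1 d.
Proof.
rewrite /subtree big_ord_recl level0 -addrA -big_split /=; congr (_ + _).
by apply: eq_bigr => j _; rewrite -levelS.
Qed.

(* [bin] of [2n] and [2n+1] extends [bin n] by one bit, so this is Kraft's
   inequality on the binary heap, with [1/(2n) + 1/(2n+1) <= 1/n] in place of the
   exact halving of the weights. *)
Lemma subtree_le n d : (0 < n)%N -> subtree n d <= n%:R^-1.
Proof.
elim: d n => [|d IH] n n0; first by rewrite /subtree big_ord0 invr_ge0.
have [dn|dn] := boolP `[<D (bin n)>].
  rewrite /subtree big_ord_recl level0 /term dn big1 ?addr0 // => j _.
  rewrite /level big_nat big1 // => i hi; rewrite /term; case: ifP => // di.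
  have [p s] := bin_heap n0 hi.
  have e := prefix_free (asboolW dn) (asboolW di) p.
  by move: s; rewrite e /= /bump leq0n; lia.
rewrite subtreeS /term (negbTE dn) add0r.
apply: le_trans (lerD (IH _ _) (IH _ _)) _; rewrite ?double_gt0 //.
have h : (n.*2.+1)%:R^-1 <= (n.*2)%:R^-1 :> R.
  by rewrite lef_pV2 ?ler_nat // posrE ltr0n ?double_gt0.
apply: le_trans (lerD (lexx _) h) _.
rewrite -muln2 natrM invfM -mulrDr ler_piMr ?invr_ge0 //; lra.
Qed.

Lemma sum_subtree d : \sum_(1 <= i < 2 ^ d) term i = subtree 1 d.
Proof.
elim: d => [|d IH]; first by rewrite big_geq // /subtree big_ord0.
rewrite /subtree big_ord_recr /= -/(subtree 1 d) -IH /level mul1n -expnS.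
by rewrite -big_cat_nat // ?leq_pexp2l // expn_gt0.
Qed.

Definition partial_sum (N : nat) : R := \sum_(1 <= i < N) term i.

Lemma partial_sum_mono : {homo partial_sum : n m / (n <= m)%N >-> n <= m}.
Proof.
move=> n m nm; rewrite /partial_sum; case: n nm => [|n] nm.
  by rewrite big_geq // sumr_ge0 // => i _; apply: term_ge0.
by rewrite [leRHS](@big_cat_nat _ _ _ n.+1) //= lerDl sumr_ge0 // => i _; apply: term_ge0.
Qed.

(** The root contributes nothing, and the subtrees at 2 and 3 at most 1/2 + 1/3. *)
Lemma partial_sum_le N : ~ D [::] -> partial_sum N <= 5 / 6.
Proof.
move=> d0; apply: le_trans (partial_sum_mono (_ : N <= 2 ^ N.+1)%N) _.
  exact: ltnW (ltn_trans (ltnSn _) (ltn_expl _ _)).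
rewrite /partial_sum sum_subtree subtreeS.
have -> : term 1 = 0 by rewrite /term; case: ifP => // /asboolP.
have := subtree_le N (isT : 0 < 2)%N; have := subtree_le N (isT : 0 < 3)%N.
rewrite -![_.*2]/2%N add0r; lra.
Qed.

Lemma partial_sum_sup : ~ D [::] ->
  limn partial_sum = sup (range partial_sum) /\ has_sup (range partial_sum).
Proof.
move=> d0; have ub : has_ubound (range partial_sum).
  by exists (5 / 6) => _ [n _ <-]; apply: partial_sum_le.
split; last by split=> //; exists (partial_sum 0), 0%N.
by apply: cvg_lim => //; apply: nondecreasing_cvgn => //; apply: partial_sum_mono.
Qed.

Lemma partial_sum_limn N : ~ D [::] -> partial_sum N <= limn partial_sum.
Proof.
by move=> d0; have [-> [_ ub]] := partial_sum_sup d0; apply: ub_le_sup => //; exists N.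
Qed.

Lemma partial_sum_gt x : ~ D [::] -> x < limn partial_sum ->
  exists N, x < partial_sum N.
Proof.
move=> d0; have [-> hs] := partial_sum_sup d0 => hx.
move: hx; rewrite -subr_gt0 => /sup_adherent /(_ hs) [_ [N _ <-]].
by rewrite subKr; exists N.
Qed.

Lemma limn_partial_sum_le : ~ D [::] -> limn partial_sum <= 5 / 6.
Proof.
move=> d0; have [-> [ne _]] := partial_sum_sup d0; apply: ge_sup => // _ [n _ <-].
exact: partial_sum_le.
Qed.

End HeapSums.

(** * Unending binary expansions *)

Section Expansion.
Local Open Scope classical_set_scope.
Local Open Scope ring_scope.
Variables (R : realType) (alpha : R).
Hypothesis alpha01 : 0 < alpha <= 1.

(** The strict comparison keeps remainders in (0, 1] instead of [0, 1): a remainder 1/2 gives the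
    digit 0 followed by ones only. *)
Fixpoint remainder (n : nat) : R :=
  if n is n'.+1 then remainder n' *+ 2 - (1 < remainder n' *+ 2)%R%:R else alpha.

Definition digit (n : nat) : bool := 1 < remainder n *+ 2.

Lemma remainder_bounds n : 0 < remainder n <= 1.
Proof.
elim: n => [//|n /andP [h1 h2]] /=.
by rewrite mulr2n; case: (ltP 1 (remainder n + _)) => h; apply/andP; split; rewrite /=; lra.
Qed.

Lemma remainder_value n :
  alpha * 2 ^+ n = (bit_value (mkseq digit n) 0)%:R + remainder n.
Proof.
elim: n => [|n IH]; first by rewrite mulr1 add0r.
rewrite exprS mulrCA IH mkseqS /bit_value foldl_rcons -/(bit_value _ _) /=.
rewrite natrD -/(digit n).
rewrite -mul2n natrM; lra.
Qed.

Lemma digit_sum n :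
  \sum_(0 <= i < n) (digit i)%:R / 2 ^+ i.+1 = alpha - remainder n / 2 ^+ n.
Proof.
elim: n => [|n IH]; first by rewrite big_geq //= expr0 divr1 subrr.
rewrite big_nat_recr //= IH /= -/(digit n) exprS.
have : (2 ^+ n : R) != 0 by rewrite expf_neq0.
by move=> h; field.
Qed.

Lemma digit_expansion : unending_expansion digit alpha.
Proof.
split.
  under eq_fun do rewrite digit_sum.
  suff : (fun n => alpha - remainder n / 2 ^+ n) @ \oo --> alpha - 0 by rewrite subr0.
  apply: cvgB; first exact: cvg_cst.
  apply: (@squeeze_cvgr _ _ _ _ (fun=> 0) (fun n => 2^-1 ^+ n)); last 2 first.
  - exact: cvg_cst.
  - by apply: cvg_expr; rewrite ger0_norm; lra.
  apply: nearW => n; have /andP [h1 h2] := remainder_bounds n.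
  rewrite exprVn divr_ge0 ?exprn_ge0 ?(ltW h1) //=.
  by rewrite ler_piMl // invr_ge0 exprn_ge0.
(* If all digits from [n] on were 0, the positive remainder would double at each step and pass its
   bound 1. *)
move=> n; apply: contrapT => hn.
have z k : remainder (n + k) = remainder n * 2 ^+ k.
  elim: k => [|k IH]; first by rewrite addn0 mulr1.
  rewrite addnS /= -/(digit _); have -> : digit (n + k) = false.
    by apply/negP => h; apply: hn; exists (n + k)%N => //; rewrite leq_addr.
  by rewrite IH exprS subr0 -mulr_natl; ring.
have /andP [r0 _] := remainder_bounds n.
pose k := Num.bound (remainder n)^-1.
have hk : (remainder n)^-1 < 2 ^+ k.
  apply: lt_le_trans (archi_boundP _) _; first by rewrite invr_ge0 ltW.
  by rewrite -natrX ler_nat ltnW // ltn_expl.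
have /andP [_] := remainder_bounds (n + k); rewrite z leNgt => /negP; apply.
by rewrite -ltr_pdivrMl // mulr1.
Qed.

End Expansion.

(** * Randomness *)

Section Randomness.
Local Open Scope ring_scope.
Variables (R : realType) (U : turing_machine).

Definition halted_term (t i : nat) : R := if halts_by U t i then i%:R^-1 else 0.

Lemma halts_by_dom t i : halts_by U t i -> dom U (bin i).
Proof.
rewrite /halts_by => h; exists (output (stutter (init U (bin i)) t)).
by apply: stutter_computes; case: step h.
Qed.

Lemma halted_term_le t i : halted_term t i <= term R (dom U) i.
Proof.
rewrite /halted_term; case: ifP => [/halts_by_dom h|_]; last exact: term_ge0.
by rewrite /term asboolT.
Qed.

Lemma add_terms_value t n a b : (0 < b)%N ->
  let ab := add_terms U t n (a, b) in (0 < ab.2)%N /\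
  ab.1%:R / ab.2%:R = a%:R / b%:R + \sum_(1 <= i < n.+1) halted_term t i.
Proof.
elim: n a b => [|n IH] a b b0; first by rewrite big_geq ?addr0.
rewrite [add_terms _ _ _ _]/= [add_term _ _ _ _]surjective_pairing.
have [|h1 h2] := IH (add_term U t n.+1 (a, b)).1 (add_term U t n.+1 (a, b)).2.
  by rewrite /add_term; case: ifP => //=; rewrite muln_gt0 b0.
split=> //; rewrite [LHS]h2 [in RHS]big_nat_recr //= [RHS]addrCA [LHS]addrC.
congr (_ + _).
rewrite /add_term /halted_term; case: ifP => _ /=; last by rewrite addr0.
have b1 : b%:R != 0 :> R by rewrite pnatr_eq0; case: b b0 h1 h2.
have n1 : n.+1%:R != 0 :> R by rewrite pnatr_eq0.
by rewrite natrD !natrM; field; apply/andP.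
Qed.

Lemma exceedsE v P t : (0 < P)%N ->
  exceeds U v P t = (v%:R / P%:R < \sum_(1 <= i < t.+1) halted_term t i).
Proof.
move=> P0; have [h1 h2] := add_terms_value t t 0 (isT : 0 < 1)%N.
move: h2; rewrite mul0r add0r => <-; rewrite /exceeds.
by rewrite ltr_pdivrMr ?ltr0n // mulrAC ltr_pdivlMr ?ltr0n // -!natrM ltr_nat.
Qed.

Lemma halted_sum_eventually N : exists t, (N <= t)%N /\
  partial_sum R (dom U) N <= \sum_(1 <= i < t.+1) halted_term t i.
Proof.
have [t [Nt ht]] : exists t, (N <= t)%N /\
    forall i, (i < N)%N -> dom U (bin i) -> halts_by U t i.
  (* Halting persists, so finitely many halting times can be replaced by their maximum. Adding [N]
     makes stage [t] reach every index below [N]. *)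
  suff [t ht] : exists t, forall i, (i < N)%N -> dom U (bin i) ->
      forall u, (t <= u)%N -> halts_by U u i.
    exists (N + t)%N; split; first exact: leq_addr.
    by move=> i iN di; apply: ht => //; rewrite leq_addl.
  elim: N => [|N [t ht]]; first by exists 0%N.
  have [[y /computes_stutter [k hk]]|nd] := pselect (dom U (bin N)).
    exists (maxn t k) => i; rewrite ltnS leq_eqVlt => /orP [/eqP -> _|iN di] u;
      rewrite geq_max => /andP [tu ku]; last exact: ht.
    by rewrite /halts_by (hk _ ku).1.
  by exists t => i; rewrite ltnS leq_eqVlt => /orP [/eqP -> /nd|] //; apply: ht.
exists t; split=> //; apply: (@le_trans _ _ (\sum_(1 <= i < N) halted_term t i)).
  rewrite /partial_sum !big_nat; apply: ler_sum => i /andP [_ iN].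
  rewrite /term; case: ifP => [/asboolP di|_]; first by rewrite /halted_term ht.
  by rewrite /halted_term; case: ifP.
have ge0 i : 0 <= halted_term t i by rewrite /halted_term; case: ifP.
case: N Nt {ht} => [|N] Nt; first by rewrite big_geq // sumr_ge0.
by rewrite [leRHS](@big_cat_nat _ _ _ N.+1) //= ?ltnS ?(ltnW Nt) // lerDl sumr_ge0.
Qed.

Lemma zetaE : zeta R U = limn (partial_sum R (dom U)).
Proof.
by rewrite /zeta; congr (limn _); apply: funext => N; rewrite big_mkcond.
Qed.

Lemma size_bit_value p : (size p < bit_value p 1)%N.
Proof.
elim/last_ind: p => [//|p b IH].
by rewrite size_rcons /bit_value foldl_rcons -/(bit_value _ _); lia.
Qed.

Lemma bin_bit_value p : bin (bit_value p 1) = p.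
Proof.
elim/last_ind: p => [|p b IH]; first by rewrite /bin trunc_log1.
rewrite /bit_value foldl_rcons -/(bit_value _ _) bin_double ?IH //.
exact: leq_trans (size_bit_value p).
Qed.

Lemma zeta_bounds : universal U -> 0 < zeta R U < 1.
Proof.
move=> hU; have d0 := universal_dom_nil hU; rewrite zetaE; apply/andP; split; last first.
  by apply: le_lt_trans (limn_partial_sum_le R hU.1 d0) _; lra.
have [p [_ [dp _ _]]] := universal_two_programs hU.
set n := bit_value p 1; have n0 : (0 < n)%N by exact: leq_trans (size_bit_value p).
apply: lt_le_trans (partial_sum_limn R hU.1 n.+1 d0).
rewrite /partial_sum big_nat_recr //= ltr_pwDr //.
  by rewrite /term bin_bit_value asboolT // invr_gt0 ltr0n.
by rewrite sumr_ge0 // => i _; apply: term_ge0.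
Qed.

Lemma short_program_halted m v t n : universal U ->
  zeta R U * 2 ^+ m <= v.+1%:R -> exceeds U v (2 ^ m) t ->
  dom U (bin n) -> (0 < n)%N -> (size (bin n) < m)%N -> (n <= t)%N && halts_by U t n.
Proof.
move=> hU hz; rewrite exceedsE ?expn_gt0 // => hex dn n0 hs; apply: contraT => hn.
have d0 := universal_dom_nil hU.
have n2 : (n < 2 ^ m)%N.
  apply: leq_trans (leq_pexp2l (isT : 0 < 2)%N hs).
  by rewrite /bin size_rev size_mkseq trunc_log_ltn.
have le1 : \sum_(1 <= i < t.+1) halted_term t i + n%:R^-1 <= zeta R U.
  rewrite zetaE; apply: le_trans (partial_sum_limn R hU.1 (maxn n t).+1 d0).
  rewrite /partial_sum [leRHS](@big_cat_nat _ _ _ t.+1) ?ltnS ?leq_maxr //=.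
  (* The term of [n] is missing from the stage either because [n] exceeds [t] or because its program
     is still running; in both cases it can be added without passing the zeta number. *)
  move: hn; rewrite negb_and -ltnNge; case: (ltnP t n) => [tn _|nt /= hn].
    rewrite [X in _ <= _ + X]big_nat_recr //= lerD //.
      by apply: ler_sum => i _; apply: halted_term_le.
    by rewrite ler_wpDl ?sumr_ge0 //; [move=> i _; apply: term_ge0|rewrite /term asboolT].
  rewrite [X in _ <= _ + X]big_geq // addr0.
  rewrite ![\sum_(1 <= i < t.+1) _](bigD1_seq n) /= ?iota_uniq ?mem_index_iota ?n0 ?ltnS //.
  rewrite {1}/halted_term (negbTE hn) add0r [term _ _ n]/term asboolT // [leLHS]addrC lerD2l.
  by apply: ler_sum => i _; apply: halted_term_le.
have P0 : 0 < 2 ^+ m :> R by rewrite exprn_gt0.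
have : v%:R / 2 ^+ m + n%:R^-1 < v.+1%:R / 2 ^+ m :> R.
  apply: lt_le_trans (_ : zeta R U <= _); last by rewrite ler_pdivlMr.
  by apply: lt_le_trans le1; rewrite ltrD2r; move: hex; rewrite natrX.
rewrite -[v.+1]addn1 natrD mulrDl ltrD2l mul1r ltf_pV2 ?posrE ?ltr0n //.
by rewrite -natrX ltr_nat ltnNge ltnW.
Qed.

End Randomness.

Theorem theorem13 (R : realType) (U0 U : turing_machine) :
  universal U0 -> universal U -> random U0 (zeta R U).
Proof.
move=> hU0 hU; have z01 := zeta_bounds R hU; split=> //.
have {}z01 : (0 < zeta R U <= 1)%R by case/andP: z01 => -> /ltW.
exists (digit (zeta R U)); first exact: digit_expansion.
(* The machine depends neither on [m] nor on [w], so one constant serves all prefixes. *)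
have [|c hc] := hU.2 (diagonal_machine U0 U).
  by move=> x y /dom_diagonal dx /dom_diagonal dy; apply: hU0.1.
exists c => m m1; apply: le_ereal_inf_tmp => _ [w hw <-].
rewrite lee_fin lerBlDr -natrD ler_nat.
set s := mkseq _ m in hw; set v := bit_value s 0.
have ss : size s = m by rewrite size_mkseq.
have zm := remainder_value (zeta R U) m.
have /andP [r0 r1] := remainder_bounds z01 m.
have P0 : (0 < 2 ^+ m :> R)%R by rewrite exprn_gt0.
(* The remainder is positive, so [v / 2 ^ m] is strictly below the limit of the partial sums and
   some stage passes it; stage 0 cannot, its sum being empty. *)
have ex : exists t, exceeds U v (2 ^ size s) t.+1.
  have [|N hN] := @partial_sum_gt R (dom U) hU.1 (v%:R / 2 ^+ m)%R (universal_dom_nil hU).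
    by rewrite -zetaE ltr_pdivrMr // zm ltrDl.
  have [[|t] [Nt ht]] := halted_sum_eventually R U N.
    by have := lt_le_trans hN ht; rewrite big_geq // ltNge divr_ge0.
  by exists t; rewrite ss (exceedsE R) ?expn_gt0 // natrX; apply: lt_le_trans ht.
have [t ht] := diagonal_computes hw ex.
move=> /hc [p pw hp]; apply: leq_trans pw; rewrite leqNgt; apply/negP => pm.
have dp : dom U (bin (bit_value p 1)).
  by rewrite bin_bit_value; exists (nseq t.*2.+1 true).
have n0 : (0 < bit_value p 1)%N by exact: leq_trans (size_bit_value p).
rewrite ss in ht.
have /andP [nt hn] : (bit_value p 1 <= t)%N && halts_by U t (bit_value p 1).
  apply: (short_program_halted (R := R) hU _ ht dp n0); last by rewrite bin_bit_value.
  by rewrite zm -natr1 lerD2l.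
have hstop : step (stutter (init U p) t) = None.
  by move: hn; rewrite /halts_by bin_bit_value; case: step.
(* As [size p < bit_value p 1 <= t], the bound is at most [2 * t], one less than the length of the
   word of ones. *)
have := size_output_stutter U p t.
rewrite (computes_inj (stutter_computes hstop) hp) size_nseq.
have := size_bit_value p; lia.
Qed.
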